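(* Let $I$ and $J$ be finite sets, and let $\{M_i\}_{i \in I}$ and $\{N_j\}_{j \in J}$ be supernatural numbers. Then $\mathbb{Z}^I \curvearrowright \prod_{i \in I} \mathbb{Z}/M_i$ and $\mathbb{Z}^J \curvearrowright \prod_{j \in J} \mathbb{Z}/N_j$ are conjugate if and only if there exist a finite set $K$, supernatural numbers $\{L_k\}_{k \in K}$ and decompositions $I = \bigsqcup_{k \in K} I_k$, $J = \bigsqcup_{k \in K} J_k$ such that - $|I_k| = |J_k|$ for all $k \in K$; - for every $k \in K$, every $i \in I_k$ and $j \in J_k$, we can write $M_i = m_i L_k$ and $N_j = n_j L_k$ for some (uniquely determined) natural numbers $m_i, n_j$ with $\gcd(m_i,L_k) = 1 = \gcd(n_j,L_k)$, and we have $\prod_{i \in I_k} \mathbb{Z}/m_i \cong \prod_{j \in J_k} \mathbb{Z}/n_j$ as groups.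
   Context: A supernatural number is a formal product $M = \prod_p p^{v_p}$ over all primes $p$, with $v_p = v_p(M) \in \{0,1,2,\dots\} \cup \{\infty\}$ and (by convention here) $\sum_p v_p = \infty$. Products of (positive) natural numbers with supernatural numbers are formed by adding exponents; $\gcd(m,L)=1$ means no prime divides both (i.e. for each prime $p$, $v_p(m) = 0$ or $v_p(L) = 0$). For a supernatural number $M$, choose natural numbers $m_k$ with $v_p(m_k) \nearrow v_p(M)$ as $k \to \infty$ for all primes $p$, and set $\mathbb{Z}/M = \varprojlim_k \mathbb{Z}/m_k$. The canonical projections give an embedding $\mathbb{Z} \hookrightarrow \mathbb{Z}/M$, hence an action $\mathbb{Z} \curvearrowright \mathbb{Z}/M$ by translation, the odometer transformation for $M$. The action $\mathbb{Z}^I \curvearrowright \prod_{i \in I} \mathbb{Z}/M_i$ is the product action. Systems $G \curvearrowright X$ and $H \curvearrowright Y$ are conjugate if there are a homeomorphism $\varphi: X \to Y$ and a group isomorphism $\rho: G \to H$ with $\varphi(g.x) = \rho(g).\varphi(x)$ for all $g \in G$, $x \in X$. *)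

(* Defs.v *)
From HB Require Import structures.
From mathcomp Require Import all_boot all_order all_algebra all_fingroup.
From mathcomp Require Import all_classical reals topology.

Set Implicit Arguments.
Unset Strict Implicit.
Unset Printing Implicit Defensive.

Import GRing.Theory.
Local Open Scope classical_set_scope.

(* [option nat] stands for {0, 1, 2, ...} together with infinity = [None]. *)
Definition addx (x y : option nat) : option nat :=
  if x is Some m then if y is Some n then Some (m + n) else None else None.

Definition lex (B : nat) (x : option nat) : bool :=
  if x is Some n then B <= n else true.

(* Only the values of [vp] at primes are meaningful. *)
Record supernatural := Supernatural {
  vp : nat -> option nat;
  vp_sum_infinite :
    forall B, exists n, lex B (\big[addx/Some 0]_(p < n | prime p) vp p)
}.

Definition is_product (M : supernatural) (m : nat) (L : supernatural) : Prop :=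
  forall p, prime p -> vp M p = addx (Some (logn p m)) (vp L p).

Definition coprimes (m : nat) (L : supernatural) : Prop :=
  forall p, prime p -> logn p m = 0 \/ vp L p = Some 0.

Definition coprime_factor (M L : supernatural) (m : nat) : Prop :=
  [/\ 0 < m, is_product M m L & coprimes m L].

(* u ---> x, for x possibly infinite; [--> \oo] means divergence to infinity. *)
Definition cvgx (u : nat -> nat) (x : option nat) : Prop :=
  if x is Some e then u @ \oo --> e else u @ \oo --> \oo.

(* A choice of the m_k with v_p(m_k) increasing to v_p(M) for every p. *)
Record approx (M : supernatural) := Approx {
  aseq :> nat -> nat;
  aseq_gt0 : forall k, 0 < aseq k;
  aseq_nd : forall p, prime p ->
    {homo (fun k => logn p (aseq k)) : k l / k <= l};
  aseq_cvg : forall p, prime p -> cvgx (fun k => logn p (aseq k)) (vp M p)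
}.

Lemma approx_exists M : inhabited (approx M).
Proof.
pose e k p := if vp M p is Some n then minn k n else k.
pose a k := \prod_(p < k | prime p) p ^ e k p.
have a0 n (f : nat -> nat) : 0 < \prod_(p < n | prime p) p ^ f p.
  by apply: prodn_cond_gt0 => p pp; rewrite expn_gt0 prime_gt0.
have lognE p n (f : nat -> nat) : prime p ->
    logn p (\prod_(q < n | prime q) q ^ f q) = if p < n then f p else 0.
  move=> pp; rewrite big_mkcond.
  elim: n => [|n IH]; first by rewrite big_ord0 logn1.
  have fac0 q : 0 < (if prime q then q ^ f q else 1).
    by case: ifP => // /prime_gt0 q0; rewrite expn_gt0 q0.
  rewrite big_ord_recr /= lognM ?fac0 ?prodn_cond_gt0//.
  rewrite IH ltnS [p <= n]leq_eqVlt; case: (eqVneq p n) => [<-|pn].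
    by rewrite pp ltnn lognX logn_prime// eqxx muln1.
  rewrite [X in _ + X](_ : _ = 0) ?addn0//.
  case: ifP => [np|_]; last exact: logn1.
  by rewrite lognX logn_prime// (negbTE pn) muln0.
split; exists a => [k|p pp k l kl|p pp]; first exact: a0.
  rewrite !lognE//; case: ifP => // pk; rewrite (leq_trans pk kl) /e.
  by case: (vp M p) => // n; rewrite leq_min geq_minr geq_min kl.
rewrite /cvgx; case vpE: (vp M p) => [n|].
  apply: cvg_near_cst; exists (maxn p.+1 n) => // k /=; rewrite geq_max.
  by case/andP => pk nk; rewrite lognE// pk /e vpE; exact/minn_idPr.
move=> A [B _ BA]; exists (maxn p.+1 B) => // k /=; rewrite geq_max.
by case/andP => pk Bk; apply: BA => /=; rewrite lognE// pk /e vpE.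
Qed.

Lemma aseq_dvd M (a : approx M) k l : k <= l -> a k %| a l.
Proof.
move=> kl; apply/dvdn_partP; first exact: aseq_gt0.
move=> p; rewrite mem_primes => /and3P[pp _ _].
by rewrite p_part pfactor_dvdn ?aseq_gt0 ?aseq_nd.
Qed.

(* Z/m for m > 0. Neither ['Z_m], which is Z/2 for m = 1, nor ['I_m], which
   carries no group structure for a general m, would do. *)
Notation cyc m := 'I_(m%N.-1.+1).

Definition reduce (m n : nat) (x : cyc n) : cyc m := inZp x.

Definition residue (m : nat) (z : int) : cyc m := (inZp 1 *~ z)%R.

Lemma reduceD m n : 0 < m -> 0 < n -> m %| n ->
  {morph @reduce m n : x y / (x + y)%R}.
Proof.
case: m n => // m [//|n] _ _ mn x y; apply: val_inj => /=.
by rewrite modn_dvdm// modnDm.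
Qed.

Lemma reduceN m n : 0 < m -> 0 < n -> m %| n ->
  {morph @reduce m n : x / (- x)%R}.
Proof.
move=> m0 n0 mn x; apply/eqP; rewrite -subr_eq0 opprK -reduceD// addNr.
by apply/eqP/val_inj; rewrite /= mod0n.
Qed.

Lemma reduce0 m n : @reduce m n 0%R = 0%R.
Proof. by apply: val_inj; rewrite /= mod0n. Qed.

Lemma reduce1 m n : 0 < m -> 0 < n -> m %| n ->
  @reduce m n (inZp 1) = inZp 1.
Proof.
by case: m n => // m [//|n] _ _ mn; apply: val_inj => /=; rewrite modn_dvdm.
Qed.

Lemma reduce_residue m n z : 0 < m -> 0 < n -> m %| n ->
  @reduce m n (residue n z) = residue m z.
Proof.
move=> m0 n0 mn.
have nat_case k : @reduce m n (inZp 1 *+ k)%R = (inZp 1 *+ k)%R.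
  elim: k => [|k IH]; first by rewrite !mulr0n reduce0.
  by rewrite !mulrS reduceD// IH reduce1.
case: z => k; first exact: nat_case.
by rewrite /residue !NegzE !mulrNz reduceN//; congr (- _)%R; exact: nat_case.
Qed.

(* Z/M, as the inverse limit of the discrete groups Z/m_k inside their
   product. *)
Definition coherent M (a : approx M) :
    set (prod_topology (fun k => discrete_topology (cyc (a k)))) :=
  [set x | forall k l, k <= l -> x k = reduce (a k) (x l : cyc (a l))].

Definition Zmod M (a : approx M) : Type := set_type (@coherent M a).

HB.instance Definition _ M (a : approx M) :=
  Topological.copy (Zmod a) (set_type (@coherent M a)).

Section ZmodGroup.
Variables (M : supernatural) (a : approx M).
Implicit Types x y : Zmod a.

Definition Zmod_coord (k : nat) (x : Zmod a) : cyc (a k) := set_val x k.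

Lemma Zmod_coordP x k l : k <= l ->
  Zmod_coord k x = reduce (a k) (Zmod_coord l x).
Proof. by move=> kl; have /set_mem := valP x; apply. Qed.

Lemma Zmod_coord_inj x y : (forall k, Zmod_coord k x = Zmod_coord k y) -> x = y.
Proof. by move=> xy; apply: val_inj; apply: functional_extensionality_dep. Qed.

Definition mk_Zmod (f : forall k, cyc (a k))
    (fP : forall k l, k <= l -> f k = reduce (a k) (f l)) : Zmod a :=
  @SigSub _ _ (@coherent M a) f (mem_set fP).

Fact add_subproof x y k l : k <= l ->
  (Zmod_coord k x + Zmod_coord k y)%R =
    reduce (a k) (Zmod_coord l x + Zmod_coord l y)%R.
Proof.
by move=> kl; rewrite reduceD ?aseq_gt0 ?aseq_dvd// -!(Zmod_coordP _ kl).
Qed.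

Fact opp_subproof x k l : k <= l ->
  (- Zmod_coord k x)%R = reduce (a k) (- Zmod_coord l x)%R.
Proof.
by move=> kl; rewrite reduceN ?aseq_gt0 ?aseq_dvd// -(Zmod_coordP _ kl).
Qed.

Fact zero_subproof k l : k <= l -> 0%R = reduce (a k) (0%R : cyc (a l)).
Proof. by rewrite reduce0. Qed.

Fact of_int_subproof z k l : k <= l ->
  residue (a k) z = reduce (a k) (residue (a l) z).
Proof. by move=> kl; rewrite reduce_residue ?aseq_gt0 ?aseq_dvd. Qed.

Definition Zmod_add x y : Zmod a := mk_Zmod (add_subproof x y).
Definition Zmod_opp x : Zmod a := mk_Zmod (opp_subproof x).
Definition Zmod_zero : Zmod a := mk_Zmod zero_subproof.

Fact Zmod_addA : associative Zmod_add.
Proof. by move=> x y z; apply: Zmod_coord_inj => k; exact: addrA. Qed.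
Fact Zmod_addC : commutative Zmod_add.
Proof. by move=> x y; apply: Zmod_coord_inj => k; exact: addrC. Qed.
Fact Zmod_add0 : left_id Zmod_zero Zmod_add.
Proof. by move=> x; apply: Zmod_coord_inj => k; exact: add0r. Qed.
Fact Zmod_addN : left_inverse Zmod_zero Zmod_opp Zmod_add.
Proof. by move=> x; apply: Zmod_coord_inj => k; exact: addNr. Qed.

HB.instance Definition _ := GRing.isZmodule.Build (Zmod a)
  Zmod_addA Zmod_addC Zmod_add0 Zmod_addN.

Definition Zmod_of_int (z : int) : Zmod a := mk_Zmod (of_int_subproof z).

Lemma Zmod_of_intD : {morph Zmod_of_int : y z / (y + z)%R}.
Proof. by move=> y z; apply: Zmod_coord_inj => k; exact: mulrzDr. Qed.

Definition odometer (z : int) (x : Zmod a) : Zmod a := (Zmod_of_int z + x)%R.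

End ZmodGroup.

Definition Zmod_prod (I : finType) (M : I -> supernatural)
    (a : forall i, approx (M i)) : topologicalType :=
  prod_topology (fun i => Zmod (a i)).

Definition odometer_prod (I : finType) (M : I -> supernatural)
    (a : forall i, approx (M i)) (z : {ffun I -> int}) (x : Zmod_prod a) :
    Zmod_prod a :=
  fun i => odometer (z i) (x i).

Arguments odometer_prod {I M} a z x.

Definition homeomorphism (X Y : topologicalType) (phi : X -> Y) : Prop :=
  continuous phi /\
  exists psi : Y -> X, [/\ continuous psi, cancel phi psi & cancel psi phi].

(* The acting groups are abelian, hence written additively. *)
Definition conjugate_actions (G H : zmodType) (X Y : topologicalType)
    (actX : G -> X -> X) (actY : H -> Y -> Y) : Prop :=
  exists (phi : X -> Y) (rho : {additive G -> H}),
    [/\ homeomorphism phi, bijective rho &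
        forall g x, phi (actX g x) = actY (rho g) (phi x)].

(* I is the disjoint union of the I_ k; some of these may be empty. *)
Definition decomposition (K I : finType) (I_ : K -> {set I}) : Prop :=
  forall i, exists! k, i \in I_ k.

(* The group \prod_(i in A) Z/m_i. *)
Definition cyclic_prod (I : finType) (A : {set I}) (m : I -> nat) :
    finGroupType :=
  {dffun forall i : {i : I | i \in A}, cyc (m (val i))}.

(* Main.v *)
Require Import Defs.
From HB Require Import structures.
From mathcomp Require Import all_boot all_order all_algebra all_fingroup.
From mathcomp Require Import all_classical reals topology.
From mathcomp Require Import zify ring.

(* A conjugacy is determined by an isomorphism rho : Z^I -> Z^J such that rho and
   its inverse are continuous for the profinite topologies induced by the Z/M_i
   and the Z/N_j; conversely such a rho extends to the completions. In matrix
   terms, N_j must divide rho_ji M_i, and M_i must divide (rho^-1)_ij N_j. So the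
   matrices are block triangular for the preorder "divides a multiple of", and
   their diagonal blocks, which correspond to the commensurability classes of
   supernatural numbers, are mutually inverse. Taking L_k to be the part of a
   class on which all its members agree, the diagonal blocks induce isomorphisms
   of the products of the Z/m_i and the Z/n_j. Conversely, if these products are
   isomorphic, counting their e-torsion shows that the prod_i gcd(e, m_i) and
   prod_j gcd(e, n_j) agree for all e, and then the lattices defined by the m_i
   and by the n_j are related by a unimodular matrix, because both can be brought
   to the same form by replacing pairs (a, b) by (lcm(a, b), gcd(a, b)). *)

Set Implicit Arguments.
Unset Strict Implicit.
Unset Printing Implicit Defensive.

Import Order.TTheory GRing.Theory Num.Theory.

(** * Conjugacies as adically continuous isomorphisms *)

Section Completions.
Local Open Scope ring_scope.
Local Open Scope classical_set_scope.

Lemma residueD m (y z : int) : residue m (y + z) = residue m y + residue m z.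
Proof. exact: mulrzDr. Qed.

Lemma residue_nat m (k : nat) : residue m k = inZp k.
Proof.
rewrite /residue -pmulrn; elim: k => [|k IH]; apply: val_inj => /=.
  by rewrite mod0n.
by rewrite mulrSr IH /= modnDm addn1.
Qed.

Lemma residue_val m (x : cyc m) : residue m (x : nat) = x.
Proof. by rewrite residue_nat; apply: val_inj; rewrite /= modn_small. Qed.

Lemma residue_eq0 m (z : int) : (0 < m)%N -> (residue m z == 0) = (m %| z)%Z.
Proof.
move=> m0.
have H (k : nat) : (residue m k == 0) = (m %| k%:Z)%Z.
  rewrite residue_nat -val_eqE /= dvdzE !absz_nat; case: m m0 => //.
case: z => k; first exact: H.
have -> : residue m (Negz k) = - residue m k.+1.
  by rewrite /residue NegzE mulrNz.
by rewrite oppr_eq0 H NegzE !dvdzE abszN.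
Qed.

Lemma residue_eqP m (y z : int) :
  (0 < m)%N -> reflect (residue m y = residue m z) (m %| y - z)%Z.
Proof.
move=> m0; rewrite -residue_eq0// residueD.
have -> : residue m (- z) = - residue m z by rewrite /residue mulrNz.
by rewrite subr_eq0; exact: eqP.
Qed.

Lemma reduce_val m n (x : cyc n) : reduce m x = residue m (x : nat).
Proof. by rewrite residue_nat. Qed.

(** Coordinates take values in discrete spaces, so they are locally constant. Together with
    [cvg_coord] this turns the topology into conditions on coordinates. *)
Lemma near_coord (I : finType) (M : I -> supernatural)
    (a : forall i, approx (M i)) (x : Zmod_prod a) (i : I) (k : nat) :
  \forall y \near x, Zmod_coord k (y i) = Zmod_coord k (x i).
Proof.
have h1 : (fun y : Zmod_prod a => y i) @ x --> x i by exact: proj_continuous.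
have h2 : (@set_val _ (@coherent (M i) (a i))) @ (x i) --> set_val (x i).
  exact: initial_continuous.
have h3 := @proj_continuous _ (fun k => discrete_topology (cyc (a i k))) k
  (set_val (x i)).
have := h1 _ (h2 _ (h3 _ (discrete_set1 _))).
exact.
Qed.

Lemma cvg_coord (I : finType) (M : I -> supernatural)
    (a : forall i, approx (M i)) (F : set_system (Zmod_prod a)) (x : Zmod_prod a) :
  Filter F ->
  (forall i k, F [set y | Zmod_coord k (y i) = Zmod_coord k (x i)]) -> F --> x.
Proof.
move=> FF Fx; apply/cvg_sup => i U [_ [[V oV <-]] Vx VU].
apply: filterS VU _.
have : nbhs (x i) V by apply: open_nbhs_nbhs; split.
move=> [_ [[W oW <-]] Wx WV]; apply: filterS (preimage_subset WV) _.
have : nbhs (set_val (x i)) W by apply: open_nbhs_nbhs; split.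
suff : (fun y : Zmod_prod a => set_val (y i)) @ F --> set_val (x i) by move=> /[apply].
apply/cvg_sup => k Z [_ [[T oT <-]] Tx TZ].
apply: filterS (preimage_subset TZ) _.
suff : F [set y : Zmod_prod a | T (Zmod_coord k (y i))] by [].
by apply: filterS (Fx i k) => y /= ->.
Qed.


(** For additive [rho] this is continuity at 0 for the topologies induced by the completions. One
    depth [k] serves all [i] because [I] is finite and each [a i] is a divisibility chain. *)
Definition adic_continuous (I J : finType) (M : I -> supernatural)
    (N : J -> supernatural) (a : forall i, approx (M i))
    (b : forall j, approx (N j)) (rho : {ffun I -> int} -> {ffun J -> int}) :=
  forall j l, exists k, forall x : {ffun I -> int},
    (forall i, (a i k %| x i)%Z) -> (b j l %| rho x j)%Z.

Lemma Zmod_coord_odometer M (a : approx M) k z (x : Zmod a) :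
  Zmod_coord k (odometer z x) = residue (a k) z + Zmod_coord k x.
Proof. by []. Qed.

(** Otherwise there are integer vectors [u k], divisible by the [a i k], whose images all fail the
    divisibility. They translate 0 to points converging to 0, so by equivariance [rho (u k)]
    eventually fixes the given coordinate of [phi 0], a contradiction. *)
Lemma equivariant_adic (I J : finType) (M : I -> supernatural)
    (N : J -> supernatural) (a : forall i, approx (M i))
    (b : forall j, approx (N j)) (phi : Zmod_prod a -> Zmod_prod b)
    (rho : {ffun I -> int} -> {ffun J -> int}) :
  continuous phi ->
  (forall g x, phi (odometer_prod a g x) = odometer_prod b (rho g) (phi x)) ->
  adic_continuous a b rho.
Proof.
move=> cphi equiv j l; apply: contrapT => /forallNP H.
have /choice[u uP] k : exists x : {ffun I -> int},
    (forall i, (a i k %| x i)%Z) /\ ~ (b j l %| rho x j)%Z.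
  by have /existsNP[x /not_implyP] := H k; exists x.
pose o : Zmod_prod a := fun i => 0.
have uo : (fun k => odometer_prod a (u k) o) @ \oo --> o.
  apply: cvg_coord => i n; exists n => // k /= nk.
  rewrite Zmod_coord_odometer -[RHS]add0r; congr (_ + _); apply/eqP.
  rewrite residue_eq0 ?aseq_gt0//; apply: dvdz_trans (proj1 (uP k) i).
  by rewrite dvdzE !absz_nat aseq_dvd.
have [n _ /(_ n (leqnn n))/=] := uo _ (cphi o _ (near_coord (phi o) j l)).
rewrite equiv Zmod_coord_odometer -[RHS]add0r => /addIr/eqP.
by rewrite residue_eq0 ?aseq_gt0//; exact: (proj2 (uP n)).
Qed.

(* The continuous extension of rho is read off on integer representatives; any
   integer vector agreeing with x to the depth chosen in [adic_continuous]
   yields the same coordinate. *)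
Lemma adic_extension (I J : finType) (M : I -> supernatural)
    (N : J -> supernatural) (a : forall i, approx (M i))
    (b : forall j, approx (N j)) (rho : {additive {ffun I -> int} -> {ffun J -> int}}) :
  adic_continuous a b rho -> exists (phi : Zmod_prod a -> Zmod_prod b),
    forall j l, exists k, forall (x : Zmod_prod a) (z : {ffun I -> int}),
      (forall i, Zmod_coord k (x i) = residue (a i k) (z i)) ->
      Zmod_coord l (phi x j) = residue (b j l) (rho z j).
Proof.
move=> rho_cont; have /choice[k' k'P] (jl : J * nat) := rho_cont jl.1 jl.2.
pose k j l := k' (j, l); have kP j l := k'P (j, l).
pose rep (x : Zmod_prod a) n : {ffun I -> int} :=
  [ffun i => (Zmod_coord n (x i) : nat)%:Z].
have phiP (x : Zmod_prod a) (z : {ffun I -> int}) j l :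
    (forall i, Zmod_coord (k j l) (x i) = residue (a i (k j l)) (z i)) ->
    residue (b j l) (rho (rep x (k j l)) j) = residue (b j l) (rho z j).
  move=> xz; apply/residue_eqP; rewrite ?aseq_gt0//.
  have -> : rho (rep x (k j l)) j - rho z j = rho (rep x (k j l) - z) j.
    by rewrite raddfB !ffunE.
  apply: kP => i; rewrite !ffunE; apply/residue_eqP; first exact: aseq_gt0.
  by rewrite residue_val.
have repP x n m i : (m <= n)%N -> Zmod_coord m (x i) = residue (a i m) (rep x n i).
  by move=> mn; rewrite (Zmod_coordP _ mn) reduce_val ffunE.
have coh x j l l' : (l <= l')%N ->
    residue (b j l) (rho (rep x (k j l)) j) =
    reduce (b j l) (residue (b j l') (rho (rep x (k j l')) j)).
  (* The representative at the larger depth is valid at both depths, so both residues come from one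
     integer vector. *)
  move=> ll'; pose n := maxn (k j l) (k j l').
  rewrite (@phiP x (rep x n) j l) => [|i]; last by apply: repP; exact: leq_maxl.
  rewrite (@phiP x (rep x n) j l') => [|i]; last by apply: repP; exact: leq_maxr.
  by rewrite reduce_residue ?aseq_gt0 ?aseq_dvd.
exists (fun x j => mk_Zmod (coh x j)) => j l; exists (k j l) => x z xz.
exact: phiP.
Qed.

Lemma coord_continuous (I J : finType) (M : I -> supernatural)
    (N : J -> supernatural) (a : forall i, approx (M i))
    (b : forall j, approx (N j)) (phi : Zmod_prod a -> Zmod_prod b) :
  (forall j l, exists k, forall x y : Zmod_prod a,
      (forall i, Zmod_coord k (x i) = Zmod_coord k (y i)) ->
      Zmod_coord l (phi x j) = Zmod_coord l (phi y j)) ->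
  continuous phi.
Proof.
move=> phiP x; apply: cvg_coord => [|j l].
  by apply: fmap_filter; exact: nbhs_filter.
have [k kP] := phiP j l.
have : \forall y \near x, forall i, Zmod_coord k (y i) = Zmod_coord k (x i).
  by apply: (@filter_forall _ _ _ (nbhs x) (nbhs_filter x)) => i; exact: near_coord.
by apply: filterS => y yx; exact: kP.
Qed.

(** Close to [x] lies an integer vector [z], on which the extensions are [rho] and [rho']. Hence
    [psi (phi x)] agrees with [z], and so with [x], at any prescribed depth. *)
Lemma adic_extension_cancel (I J : finType) (M : I -> supernatural)
    (N : J -> supernatural) (a : forall i, approx (M i))
    (b : forall j, approx (N j)) (rho : {ffun I -> int} -> {ffun J -> int})
    (rho' : {ffun J -> int} -> {ffun I -> int})
    (phi : Zmod_prod a -> Zmod_prod b) (psi : Zmod_prod b -> Zmod_prod a) :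
  cancel rho rho' ->
  (forall j l, exists k, forall (x : Zmod_prod a) (z : {ffun I -> int}),
      (forall i, Zmod_coord k (x i) = residue (a i k) (z i)) ->
      Zmod_coord l (phi x j) = residue (b j l) (rho z j)) ->
  (forall i l, exists k, forall (x : Zmod_prod b) (z : {ffun J -> int}),
      (forall j, Zmod_coord k (x j) = residue (b j k) (z j)) ->
      Zmod_coord l (psi x i) = residue (a i l) (rho' z i)) ->
  cancel phi psi.
Proof.
move=> rhoK phiP psiP x; apply: functional_extensionality_dep => i.
apply: Zmod_coord_inj => k; have [l lP] := psiP i k.
have /choice[m mP] j := phiP j l.
(* At depth [n], [z] represents [x] both at depth [k] and at the depths [m j] from which [phi x] is
   read off at depth [l]. *)
pose n := maxn k (\max_j m j).
pose z : {ffun I -> int} := [ffun i => (Zmod_coord n (x i) : nat)%:Z].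
have xz r i' : (r <= n)%N -> Zmod_coord r (x i') = residue (a i' r) (z i').
  by move=> rn; rewrite (Zmod_coordP _ rn) reduce_val ffunE.
rewrite (lP _ (rho z)) => [|j]; first by rewrite rhoK xz ?leq_maxl.
by apply: mP => i'; apply: xz; rewrite leq_max leq_bigmax orbT.
Qed.

Lemma conjugate_adicP (I J : finType) (M : I -> supernatural)
    (N : J -> supernatural) (a : forall i, approx (M i))
    (b : forall j, approx (N j)) :
  conjugate_actions (odometer_prod a) (odometer_prod b) <->
  exists (rho : {additive {ffun I -> int} -> {ffun J -> int}})
      (rho' : {additive {ffun J -> int} -> {ffun I -> int}}),
    [/\ cancel rho rho', cancel rho' rho,
        adic_continuous a b rho & adic_continuous b a rho'].
Proof.
split=> [[phi [rho [[cphi [psi [cpsi phiK psiK]]] [r rK rK'] equiv]]]|].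
  have addr : zmod_morphism r.
    by move=> x y; apply: (can_inj rK); rewrite raddfB !rK'.
  pose rA := GRing.isZmodMorphism.Build _ _ r addr.
  pose rho' : {additive _ -> _} := HB.pack r rA.
  exists rho, rho'; split=> //; first exact: equivariant_adic equiv.
  apply: (equivariant_adic cpsi) => g x.
  by rewrite -{1}(psiK x) -{1}(rK' g) -equiv phiK.
move=> [rho [rho' [rhoK rhoK' crho crho']]].
have [phi phiP] := adic_extension crho.
have [psi psiP] := adic_extension crho'.
(* Integer vectors are dense in the completion. *)
have lift (I' : finType) (M' : I' -> supernatural) (a' : forall i, approx (M' i))
    (x : Zmod_prod a') k : exists z : {ffun I' -> int},
    forall i, Zmod_coord k (x i) = residue (a' i k) (z i).
  exists [ffun i => (Zmod_coord k (x i) : nat)%:Z] => i.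
  by rewrite ffunE residue_val.
exists phi, rho; split; last first.
- move=> g x; apply: functional_extensionality_dep => j.
  apply: Zmod_coord_inj => l; have [k kP] := phiP j l.
  have [z xz] := lift _ _ _ x k.
  rewrite Zmod_coord_odometer (kP x z)// (kP _ (g + z)) => [|i].
    by rewrite raddfD ffunE residueD.
  by rewrite Zmod_coord_odometer ffunE residueD xz.
- by exists rho'.
split; [|exists psi; split]; last 2 first.
- exact: adic_extension_cancel rhoK phiP psiP.
- exact: adic_extension_cancel rhoK' psiP phiP.
- apply: coord_continuous => j l; have [k kP] := phiP j l.
  exists k => x y xy; have [z yz] := lift _ _ _ y k.
  by rewrite !(kP _ z)// => i; rewrite xy.
- apply: coord_continuous => j l; have [k kP] := psiP j l.
  exists k => x y xy; have [z yz] := lift _ _ _ y k.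
  by rewrite !(kP _ z)// => i; rewrite xy.
Qed.

End Completions.

(** * Matrix entries *)

Section Entries.
Local Open Scope ring_scope.
Local Open Scope classical_set_scope.

Definition unitv (I : finType) (i : I) : {ffun I -> int} :=
  [ffun i' => (i' == i)%:R].

Definition entry (I J : finType) (rho : {ffun I -> int} -> {ffun J -> int})
    (j : J) (i : I) : int := rho (unitv i) j.

Lemma additive_entryE (I J : finType)
    (rho : {additive {ffun I -> int} -> {ffun J -> int}}) x j :
  rho x j = \sum_i entry rho j i * x i.
Proof.
have {1}-> : x = \sum_i unitv i *~ x i.
  apply/ffunP => i; rewrite sum_ffunE (bigD1 i)//= ffunMzE ffunE eqxx intz.
  rewrite big1 ?addr0// => i' i'i.
  by rewrite ffunMzE ffunE eq_sym (negPf i'i) mul0rz.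
rewrite raddf_sum sum_ffunE; apply: eq_bigr => i _.
by rewrite raddfMz ffunMzE mulrzz.
Qed.

Lemma entry_mul (I J : finType)
    (rho : {additive {ffun I -> int} -> {ffun J -> int}}) 
    (rho' : {additive {ffun J -> int} -> {ffun I -> int}}) i i' :
  cancel rho rho' ->
  \sum_j entry rho' i j * entry rho j i' = (i == i')%:R.
Proof.
by move=> rhoK; rewrite -[LHS]additive_entryE rhoK ffunE.
Qed.

(* N divides c M, at every prime, unless c = 0. *)
Definition scales (M N : supernatural) (c : int) : Prop :=
  c = 0 \/ forall p, prime p ->
    forall e, lex (e + logn p `|c|) (vp N p) -> lex e (vp M p).

(** The exponents of the [a k] at [p] are nondecreasing, so their limit reaches [e] exactly when
    some term does. *)
Lemma approx_lexP M (a : approx M) p e :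
  prime p -> lex e (vp M p) <-> exists k, (e <= logn p (a k))%N.
Proof.
move=> pp; have := aseq_cvg a pp; case: (vp M p) => [n|] /= cv.
  have [K _ KP] := cv _ (discrete_set1 n).
  split=> [en|[k ek]]; first by exists K; rewrite (KP K (leqnn K)).
  rewrite -(KP (maxn k K) (leq_maxr _ _)); apply: leq_trans ek _.
  by apply: aseq_nd => //; exact: leq_maxl.
split=> // _.
have [K _ KP] := cv [set n | (e <= n)%N] (nbhs_infty_ge e).
by exists K; exact: (KP K (leqnn K)).
Qed.

(** For fixed [l] only the finitely many primes dividing [b l] matter, so one [k] can be taken large
    enough for all of them. *)
Lemma scales_approxP M N (a : approx M) (b : approx N) c :
  scales M N c <-> forall l, exists k, (b l %| c * (a k : nat))%Z.
Proof.
split=> [[->|cMN] l|cMN].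
- by exists 0%N; rewrite mul0r dvdz0.
- have [->|c0] := eqVneq c 0; first by exists 0%N; rewrite mul0r dvdz0.
  have /choice[k kP] p : exists k, prime p ->
      (logn p (b l) <= logn p `|c| + logn p (a k))%N.
    have [pp|] := boolP (prime p); last by exists 0%N.
    (* If [c] alone supplies the exponent, any [k] will do; otherwise the subtraction below is
       exact. *)
    have [|] := leqP (logn p (b l)) (logn p `|c|).
      by exists 0%N => _; rewrite (leq_trans _ (leq_addr _ _)).
    move=> /ltnW cb; have /(approx_lexP a _ pp)[k ek] :
        lex (logn p (b l) - logn p `|c|) (vp M p).
      by apply: cMN => //; rewrite subnK//; apply/(approx_lexP b _ pp); exists l.
    by exists k => _; lia.
  exists (\max_(p < (b l).+1) k p).
  rewrite dvdzE abszM !absz_nat; apply/dvdn_partP; first exact: aseq_gt0.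
  move=> p; rewrite mem_primes => /and3P[pp _ pb].
  rewrite p_part pfactor_dvdn ?muln_gt0 ?absz_gt0 ?c0 ?aseq_gt0//.
  rewrite lognM ?absz_gt0 ?aseq_gt0//; apply: leq_trans (kP p pp) _.
  rewrite leq_add2l aseq_nd//.
  have pl : (p < (b l).+1)%N by rewrite ltnS dvdn_leq ?aseq_gt0.
  exact: (leq_bigmax (Ordinal pl)).
- have [->|c0] := eqVneq c 0; [by left|right=> p pp e].
  move=> /(approx_lexP b _ pp)[l el]; have [k] := cMN l.
  rewrite dvdzE abszM !absz_nat => /(dvdn_leq_log p).
  rewrite muln_gt0 absz_gt0 c0 aseq_gt0 lognM ?absz_gt0 ?aseq_gt0// => /(_ erefl) bk.
  by apply/(approx_lexP a _ pp); exists k; lia.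
Qed.

(** Multiples of unit vectors isolate the entries; conversely, the maximum of the depths found for
    the entries of a row works for every vector. *)
Lemma adic_entryP (I J : finType) (M : I -> supernatural)
    (N : J -> supernatural) (a : forall i, approx (M i))
    (b : forall j, approx (N j))
    (rho : {additive {ffun I -> int} -> {ffun J -> int}}) :
  adic_continuous a b rho <-> forall i j, scales (M i) (N j) (entry rho j i).
Proof.
split=> [crho i j|sc j l].
  apply/(scales_approxP (a i) (b j)) => l; have [k kP] := crho j l; exists k.
  have := kP (unitv i *~ (a i k : nat)).
  rewrite raddfMz ffunMzE mulrzz; apply => i'.
  rewrite ffunMzE ffunE; case: eqP => [->|_]; last by rewrite mul0rz dvdz0.
  by rewrite intz dvdzz.
have /choice[k kP] i : exists k, (b j l %| entry rho j i * (a i k : nat))%Z.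
  by have /(scales_approxP (a i) (b j))/(_ l) := sc i j.
exists (\max_i k i)%N => x ax; rewrite additive_entryE.
apply: (big_ind (fun s => (b j l %| s)%Z)) => [|y z|i _]; [exact: dvdz0|exact: rpredD|].
apply: dvdz_trans (kP i) _; apply: dvdz_mul => //.
apply: dvdz_trans (ax i); rewrite dvdzE !absz_nat aseq_dvd//.
exact: leq_bigmax.
Qed.

End Entries.

(** * Products of cyclic groups *)

Section CyclicProducts.
Local Open Scope ring_scope.

Definition liftz (I : finType) (S : {set I}) (m : I -> nat)
    (x : cyclic_prod S m) (i : I) : int :=
  if insub i is Some i' then (x i' : nat)%:Z else 0.

Definition projz (I : finType) (S : {set I}) (m : I -> nat) (z : I -> int) :
    cyclic_prod S m :=
  [ffun i : {i : I | i \in S} => residue (m (val i)) (z (val i))].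

Lemma projzK (I : finType) (S : {set I}) (m : I -> nat) (x : cyclic_prod S m) :
  projz S m (liftz x) = x.
Proof. by apply/ffunP => i; rewrite ffunE /liftz valK residue_val. Qed.

Lemma eq_projz (I : finType) (S : {set I}) (m : I -> nat) (y z : I -> int) :
  (forall i, (0 < m i)%N) -> (forall i, i \in S -> (m i %| y i - z i)%Z) ->
  projz S m y = projz S m z.
Proof.
move=> m0 yz; apply/ffunP => -[i iS]; rewrite !ffunE.
by apply/residue_eqP => //; exact: yz.
Qed.

Lemma liftz_projz (I : finType) (S : {set I}) (m : I -> nat) (z : I -> int) i :
  (forall i, (0 < m i)%N) -> i \in S ->
  (m i %| liftz (projz S m z) i - z i)%Z.
Proof.
move=> m0 iS; apply/residue_eqP => //.
by rewrite /liftz insubT ffunE /= residue_val.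
Qed.

Lemma projzM (I : finType) (S : {set I}) (m : I -> nat) (y z : I -> int) :
  (projz S m y * projz S m z)%g = projz S m (fun i => y i + z i).
Proof. by apply/ffunP => i; rewrite !ffunE residueD. Qed.

Definition block_map (I J : finType) (S : {set I}) (T : {set J})
    (m : I -> nat) (n : J -> nat) (A : J -> I -> int) (x : cyclic_prod S m) :=
  projz T n (fun j => \sum_(i in S) A j i * liftz x i).

(** Two representatives of a residue differ by a multiple of [m i], and [n j] divides [A j i * m i],
    so the choice of representatives made in [block_map] does not affect the result. *)
Lemma block_map_projz (I J : finType) (S : {set I}) (T : {set J})
    (m : I -> nat) (n : J -> nat) (A : J -> I -> int) (z : I -> int) :
  (forall i, (0 < m i)%N) -> (forall j, (0 < n j)%N) ->
  (forall i j, i \in S -> j \in T -> (n j %| A j i * m i)%Z) ->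
  block_map T n A (projz S m z) =
    projz T n (fun j => \sum_(i in S) A j i * z i).
Proof.
move=> m0 n0 Amn; apply: eq_projz => // j jT; rewrite -sumrB.
apply: rpred_sum => i iS; rewrite -mulrBr; apply: dvdz_trans (Amn i j iS jT) _.
by apply: dvdz_mul => //; exact: liftz_projz.
Qed.

Lemma block_mapM (I J : finType) (S : {set I}) (T : {set J})
    (m : I -> nat) (n : J -> nat) (A : J -> I -> int) :
  (forall i, (0 < m i)%N) -> (forall j, (0 < n j)%N) ->
  (forall i j, i \in S -> j \in T -> (n j %| A j i * m i)%Z) ->
  {morph @block_map I J S T m n A : x y / (x * y)%g}.
Proof.
move=> m0 n0 Amn x y; rewrite -[in LHS](projzK x) -[in LHS](projzK y).
rewrite projzM block_map_projz// projzM; congr projz; apply/funext => j.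
by rewrite -big_split; apply: eq_bigr => i _; rewrite mulrDr.
Qed.

(** On integer representatives the composite is the product of the blocks of [B] and [A], which is
    the identity. *)
Lemma block_mapK (I J : finType) (S : {set I}) (T : {set J})
    (m : I -> nat) (n : J -> nat) (A : J -> I -> int) (B : I -> J -> int) :
  (forall i, (0 < m i)%N) -> (forall j, (0 < n j)%N) ->
  (forall i j, i \in S -> j \in T -> (n j %| A j i * m i)%Z) ->
  (forall j i, j \in T -> i \in S -> (m i %| B i j * n j)%Z) ->
  (forall i i', i \in S -> i' \in S ->
    \sum_(j in T) B i j * A j i' = (i == i')%:R) ->
  cancel (@block_map I J S T m n A) (@block_map J I T S n m B).
Proof.
move=> m0 n0 Amn Bnm BA x; rewrite [block_map T n A x]/block_map.
rewrite block_map_projz// -[RHS]projzK.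
apply/ffunP => -[i iS]; rewrite !ffunE /=; congr residue.
transitivity (\sum_(i' in S) (i == i')%:R * liftz x i').
  under eq_bigr => j _ do rewrite mulr_sumr.
  rewrite exchange_big; apply: eq_bigr => i' i'S.
  by rewrite -BA// mulr_suml; apply: eq_bigr => j _; rewrite mulrA.
rewrite (bigD1 i)//= eqxx mul1r big1 ?addr0// => i' /andP[_ i'i].
by rewrite eq_sym (negPf i'i) mul0r.
Qed.

Lemma block_map_isog (I J : finType) (S : {set I}) (T : {set J})
    (m : I -> nat) (n : J -> nat) (A : J -> I -> int) (B : I -> J -> int) :
  (forall i, (0 < m i)%N) -> (forall j, (0 < n j)%N) ->
  (forall i j, i \in S -> j \in T -> (n j %| A j i * m i)%Z) ->
  (forall j i, j \in T -> i \in S -> (m i %| B i j * n j)%Z) ->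
  (forall i i', i \in S -> i' \in S ->
    \sum_(j in T) B i j * A j i' = (i == i')%:R) ->
  (forall j j', j \in T -> j' \in T ->
    \sum_(i in S) A j i * B i j' = (j == j')%:R) ->
  [set: cyclic_prod S m] \isog [set: cyclic_prod T n].
Proof.
move=> m0 n0 Amn Bnm BA AB; pose f := @block_map I J S T m n A.
have fM : {in [set: cyclic_prod S m] &, {morph f : x y / (x * y)%g}}.
  by move=> x y _ _; exact: block_mapM.
have fK : cancel f (@block_map J I T S n m B) by exact: block_mapK.
have fK' : cancel (@block_map J I T S n m B) f by exact: block_mapK.
apply/isogP; exists (Morphism fM).
  by apply/injmP => x y _ _; exact: can_inj fK _ _.
apply/setP => y; rewrite !inE; apply/morphimP.
by exists (block_map S m B y); rewrite ?inE//= fK'.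
Qed.

End CyclicProducts.

(** * Commensurable supernatural numbers *)

Section Commensurability.
Local Open Scope ring_scope.

Lemma lex_inj (x y : option nat) : (forall e, lex e x <-> lex e y) -> x = y.
Proof.
case: x y => [x|] [y|] //= xy.
- by congr Some; apply/eqP; rewrite eqn_leq ((xy x).1 (leqnn x)) ((xy y).2 (leqnn y)).
- by have := (xy x.+1).2 isT; rewrite ltnn.
- by have := (xy y.+1).1 isT; rewrite ltnn.
Qed.

Lemma scales1 M : scales M M 1.
Proof. by right=> p _ e; rewrite absz1 logn1 addn0. Qed.

Lemma scales_trans M N P c d : scales M N c -> scales N P d -> scales M P (c * d).
Proof.
move=> [->|MN]; first by rewrite mul0r; left.
move=> [->|NP]; first by rewrite mulr0; left.
have [->|c0] := eqVneq c 0; first by rewrite mul0r; left.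
have [->|d0] := eqVneq d 0; first by rewrite mulr0; left.
right=> p pp e; rewrite abszM lognM ?absz_gt0// addnA => ecd.
by apply: MN => //; apply: NP.
Qed.

(** The preorder that makes the matrices block triangular. The divisor comes first here, but second
    in [scales]. *)
Definition quasidvd (N M : supernatural) : Prop := exists2 c, c != 0 & scales M N c.

Definition commensurable (M N : supernatural) : Prop :=
  quasidvd M N /\ quasidvd N M.

Lemma quasidvd_trans M N P : quasidvd M N -> quasidvd N P -> quasidvd M P.
Proof.
move=> [c c0 NM] [d d0 PN]; exists (d * c); first by rewrite mulf_neq0.
exact: scales_trans NM.
Qed.

Lemma commensurable_refl M : commensurable M M.
Proof. by split; exists 1 => //; exact: scales1. Qed.

Lemma commensurable_sym M N : commensurable M N -> commensurable N M.
Proof. by case. Qed.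

Lemma commensurable_trans N M P :
  commensurable M N -> commensurable N P -> commensurable M P.
Proof.
by move=> [MN NM] [NP PN]; split; [exact: quasidvd_trans NP|exact: quasidvd_trans NM].
Qed.

(** The prime divisors of a nonzero [c] are at most its absolute value, and [c] shifts each exponent
    by a finite amount only. *)
Lemma quasidvd_vp M N : quasidvd M N ->
  exists n, forall p, prime p ->
    ((n <= p)%N -> forall e, lex e (vp M p) -> lex e (vp N p)) /\
    (vp M p = None -> vp N p = None).
Proof.
move=> [c c0 [cE|cMN]]; first by rewrite cE eqxx in c0.
exists `|c|.+1 => p pp; split=> [cp e eM|Mp].
  apply: cMN => //; rewrite lognE pp absz_gt0 c0 gtnNdvd ?absz_gt0//.
  by rewrite addn0.
by apply: lex_inj => e; split=> // _; apply: cMN => //; rewrite Mp.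
Qed.

Lemma commensurable_vp M N : commensurable M N ->
  exists n, forall p, prime p ->
    ((n <= p)%N -> vp M p = vp N p) /\ (vp M p = None <-> vp N p = None).
Proof.
move=> [/quasidvd_vp[m mP] /quasidvd_vp[n nP]]; exists (maxn m n) => p pp.
have [mp mN] := mP p pp; have [np nN] := nP p pp; split; last by split.
by rewrite geq_max => /andP[mlep nlep]; apply: lex_inj => e; split; [exact: mp|exact: np].
Qed.

Lemma logn_prod_pow (P : pred nat) (f : nat -> nat) n p : prime p ->
  logn p (\prod_(q < n | prime q && P q) q ^ f q)%N =
    if (p < n)%N && P p then f p else 0%N.
Proof.
move=> pp.
have gt0 m : (0 < \prod_(q < m | prime q && P q) q ^ f q)%N.
  by apply: prodn_cond_gt0 => q /andP[qp _]; rewrite expn_gt0 prime_gt0.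
elim: n => [|n IH]; first by rewrite big_ord0 logn1.
have ngt0 : (0 < if prime n && P n then n ^ f n else 1)%N.
  by case: ifP => // /andP[np _]; rewrite expn_gt0 prime_gt0.
rewrite big_mkcond big_ord_recr -big_mkcond /= lognM ?gt0// IH.
rewrite ltnS [(p <= n)%N]leq_eqVlt; have [<-|pn] := eqVneq p n.
  by rewrite pp ltnn /=; case: (P p); rewrite ?logn1// lognX logn_prime// eqxx muln1.
rewrite [X in (_ + X)%N](_ : _ = 0%N) ?addn0//.
case: ifP => [/andP[np _]|_]; last exact: logn1.
by rewrite lognX logn_prime// (negPf pn) muln0.
Qed.

Lemma sum_logn_le m n :
  (\sum_(p < n | prime p) logn p m <= \sum_(p < m.+1 | prime p) logn p m)%N.
Proof.
rewrite -!(big_mkord prime (fun p => logn p m)).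
have [nm|/ltnW mn] := leqP n m.+1.
  by rewrite [leqRHS](big_cat_nat (n := n))//= leq_addr.
rewrite (big_cat_nat (n := m.+1))//= [X in (_ + X)%N]big1_seq ?addn0//.
move=> p /andP[pp]; rewrite mem_index_iota => /andP[mp _].
by case: m mp {mn} => [|m] mp; [rewrite logn0|rewrite lognE pp gtnNdvd].
Qed.

(** The exponents of [m] have a finite sum, so removing them leaves an infinite sum infinite. *)
Lemma cofactor_sum_infinite M m (g : nat -> option nat) :
  (forall p, prime p -> vp M p = addx (Some (logn p m)) (g p)) ->
  forall B, exists n, lex B (\big[addx/Some 0%N]_(p < n | prime p) g p).
Proof.
move=> Mg B.
have [n] := vp_sum_infinite M (B + \sum_(p < m.+1 | prime p) logn p m).
have -> : \big[addx/Some 0%N]_(p < n | prime p) vp M p =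
    addx (Some (\sum_(p < n | prime p) logn p m)%N)
      (\big[addx/Some 0%N]_(p < n | prime p) g p).
  apply: (big_rec3 (fun x y z => x = addx (Some y) z)) => // p x y z pp ->.
  by rewrite Mg//; case: (g p) z => [?|] [?|]//=; congr Some; lia.
move=> nB; exists n; move: nB (sum_logn_le m n).
by case: (\big[_/_]_(_ < _ | _) g _) => //= s; lia.
Qed.

(** At good primes, where all [X t] agree with [Y], [L] takes the common exponent; at bad primes it
    takes 0, and the exponent of [X t] goes into [m]. By commensurability the bad primes are
    finitely many and have finite exponents. *)
Lemma common_cofactor (T : finType) (X : T -> supernatural) Y :
  (forall t, commensurable (X t) Y) ->
  exists L, forall t, exists m, coprime_factor (X t) L m.
Proof.
move=> XY; have /choice[n nP] t := commensurable_vp (XY t).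
pose good p := [forall t, vp (X t) p == vp Y p].
pose b := (\max_t n t)%N.
have goodb p : prime p -> (b <= p)%N -> good p.
  move=> pp bp; apply/forallP => t; apply/eqP; apply: (proj1 (nP t p pp)).
  by apply: leq_trans bp; exact: leq_bigmax.
pose g p := if good p then vp Y p else Some 0%N.
(* The default of [odflt] stands for an infinite exponent, which [mP] excludes at bad primes. *)
pose m (Z : supernatural) : nat :=
  (\prod_(p < b | prime p && ~~ good p) p ^ odflt 0 (vp Z p))%N.
have m_gt0 Z : (0 < m Z)%N.
  by apply: prodn_cond_gt0 => q /andP[qp _]; rewrite expn_gt0 prime_gt0.
have logm Z p : prime p ->
    logn p (m Z) = if (p < b)%N && ~~ good p then odflt 0%N (vp Z p) else 0%N.
  exact: (@logn_prod_pow (fun p => ~~ good p) (fun p => odflt 0%N (vp Z p))).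
have mP (Z : supernatural) : (forall p, prime p -> good p -> vp Z p = vp Y p) ->
    (forall p, prime p -> ~~ good p -> vp Z p <> None) ->
    forall p, prime p -> vp Z p = addx (Some (logn p (m Z))) (g p).
  move=> Zgood Zbad p pp; rewrite logm// /g.
  have [gp|gp] := boolP (good p); first by rewrite andbF Zgood//; case: vp.
  have -> : (p < b)%N by rewrite ltnNge; apply: contra gp; exact: goodb.
  by have := Zbad _ pp gp; case: vp => //= e _; rewrite addn0.
(* If [Y] had infinite exponent at [p], so would every [X t], and [p] would be good. *)
have Ybad p : prime p -> ~~ good p -> vp Y p <> None.
  move=> pp /forallPn[t] /eqP + YN; apply.
  by rewrite YN; apply/(proj2 (nP t p pp)).
pose L := Supernatural (cofactor_sum_infinite (mP Y (fun _ _ _ => erefl) Ybad)).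
exists L => t; exists (m (X t)); split => // p pp.
  apply: (mP (X t)) => // q qp => [/forallP/(_ t)/eqP//|qb].
  by move/(proj2 (nP t q qp)); exact: (Ybad q qp qb).
rewrite logm//= /g; case: (good p); [by left; rewrite andbF|by right].
Qed.

(** Where [L] has exponent 0, [m] carries the whole exponent of [M]; at all other primes its
    exponent is 0. *)
Lemma coprime_factor_unique M L m :
  coprime_factor M L m -> unique (coprime_factor M L) m.
Proof.
move=> mP; split=> // m' [m'0 Mm' com']; case: mP => m0 Mm com.
apply: eqn_from_log => // p; have [pp|np] := boolP (prime p); last first.
  by rewrite (lognE p m) (lognE p m') (negPf np).
have [m_0|L0] := com p pp.
  have [->//|L0] := com' p pp.
  by have := Mm p pp; rewrite (Mm' p pp) L0 /= !addn0 => -[].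
by have := Mm p pp; rewrite (Mm' p pp) L0 /= !addn0 => -[].
Qed.

(** At a prime dividing [n] the exponent of [L] is 0, so [M] and [N] have there the exponents of [m]
    and [n]. *)
Lemma coprime_factor_scales M N L m n c :
  coprime_factor M L m -> coprime_factor N L n -> scales M N c -> (n %| c * m)%Z.
Proof.
move=> [m0 Mm com] [n0 Nn con] [->|MN]; first by rewrite mul0r dvdz0.
have [->|c0] := eqVneq c 0; first by rewrite mul0r dvdz0.
rewrite dvdzE abszM !absz_nat; apply/dvdn_partP => // p.
rewrite mem_primes => /and3P[pp _ _].
rewrite p_part pfactor_dvdn ?muln_gt0 ?absz_gt0 ?c0//.
rewrite lognM ?absz_gt0//; have [->//|L0] := con p pp.
have := MN p pp (logn p n - logn p `|c|)%N; rewrite Mm// Nn// L0 /= !addn0.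
by have [|/ltnW] := leqP (logn p n) (logn p `|c|); lia.
Qed.

(** In the full product of the matrices, a nonzero term at [j] makes [M i] quasi-divide [N j], and
    [N j] quasi-divide [M i'], which is commensurable with [M i]. Such a [j] lies in [T], so
    restricting the sum to [T] loses nothing. *)
Lemma block_inverse (I J : finType) (M : I -> supernatural)
    (N : J -> supernatural) (S : {set I}) (T : {set J})
    (rho : {additive {ffun I -> int} -> {ffun J -> int}})
    (rho' : {additive {ffun J -> int} -> {ffun I -> int}}) :
  cancel rho rho' ->
  (forall i j, scales (M i) (N j) (entry rho j i)) ->
  (forall j i, scales (N j) (M i) (entry rho' i j)) ->
  (forall i i', i \in S -> i' \in S -> commensurable (M i) (M i')) ->
  (forall i j, i \in S -> commensurable (M i) (N j) -> j \in T) ->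
  forall i i', i \in S -> i' \in S ->
    \sum_(j in T) entry rho' i j * entry rho j i' = (i == i')%:R.
Proof.
move=> rhoK MN NM SS ST i i' iS i'S; rewrite -(entry_mul _ _ rhoK).
rewrite [RHS](bigID (mem T))/= [X in _ = _ + X]big1 ?addr0// => j jT.
have [->|B0] := eqVneq (entry rho' i j) 0; first by rewrite mul0r.
have [->|A0] := eqVneq (entry rho j i') 0; first by rewrite mulr0.
have MiNj : quasidvd (M i) (N j) by exists (entry rho' i j).
have NjMi' : quasidvd (N j) (M i') by exists (entry rho j i').
case/negP: jT; apply: (ST i j iS); split => //.
by apply: quasidvd_trans NjMi' _; exact: (proj2 (SS i i' iS i'S)).
Qed.

Lemma card_block (I J : finType) (S : {set I}) (T : {set J})
    (A : J -> I -> int) (B : I -> J -> int) :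
  (forall i i', i \in S -> i' \in S ->
    \sum_(j in T) B i j * A j i' = (i == i')%:R) ->
  (forall j j', j \in T -> j' \in T ->
    \sum_(i in S) A j i * B i j' = (j == j')%:R) ->
  #|S| = #|T|.
Proof.
(* Both cardinals are the trace of AB, that is, of BA. *)
move=> BA AB; apply/eqP; rewrite -(eqr_nat int) -!sum1_card !natr_sum.
rewrite (eq_bigr (fun i => \sum_(j in T) B i j * A j i)) => [|i iS].
  rewrite exchange_big /=; apply/eqP/eq_bigr => j jT.
  by under eq_bigr do rewrite mulrC; rewrite AB// eqxx.
by rewrite BA// eqxx.
Qed.

Lemma block_structure (I J : finType) (M : I -> supernatural)
    (N : J -> supernatural)
    (rho : {additive {ffun I -> int} -> {ffun J -> int}})
    (rho' : {additive {ffun J -> int} -> {ffun I -> int}}) :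
  cancel rho rho' -> cancel rho' rho ->
  (forall i j, scales (M i) (N j) (entry rho j i)) ->
  (forall j i, scales (N j) (M i) (entry rho' i j)) ->
  exists (K : finType) (L : K -> supernatural)
         (I_ : K -> {set I}) (J_ : K -> {set J}),
    [/\ decomposition I_, decomposition J_,
        forall k, #|I_ k| = #|J_ k| &
        exists (m : I -> nat) (n : J -> nat), forall k,
          [/\ forall i, i \in I_ k -> unique (coprime_factor (M i) (L k)) (m i),
              forall j, j \in J_ k -> unique (coprime_factor (N j) (L k)) (n j) &
              [set: cyclic_prod (I_ k) m] \isog [set: cyclic_prod (J_ k) n]]].
Proof.
move=> rhoK rhoK' MN NM.
(* Commensurable numbers define the same predicate, so they pick the same index. Classes are named
   by these indices, and [K] is [I], with empty blocks at the indices never picked. *)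
pose rep X := [pick i | `[< commensurable X (M i) >]].
have rep_eq X Y : commensurable X Y -> rep X = rep Y.
  move=> XY; apply: eq_pick => i; apply/asboolP/asboolP; apply: commensurable_trans => //.
  exact: commensurable_sym.
have repP X k : rep X = Some k -> commensurable X (M k).
  by rewrite /rep; case: pickP => // i /asboolP + [<-].
have repMP i : exists k, rep (M i) = Some k.
  rewrite /rep; case: pickP => [k|/(_ i)/asboolP[]]; first by exists k.
  exact: commensurable_refl.
(* The diagonal entry at [j] of the product of the matrices is 1, so some [i] contributes a nonzero
   term; its two factors make [N j] and [M i] commensurable. *)
have repNP j : exists k, rep (N j) = Some k.
  have : \sum_i entry rho j i * entry rho' i j != 0 by rewrite entry_mul// eqxx.
  case: (pickP (fun i => entry rho j i * entry rho' i j != 0)) => [i|z]; last first.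
    by rewrite big1 ?eqxx// => i _; apply/eqP; move/negbFE: (z i).
  rewrite mulf_eq0 negb_or => /andP[A0 B0] _.
  have [k ik] := repMP i; exists k; rewrite -ik; apply: rep_eq.
  by split; [exists (entry rho j i)|exists (entry rho' i j)].
pose I_ k := [set i | rep (M i) == Some k]; pose J_ k := [set j | rep (N j) == Some k].
have /choice[L LP] k : exists L,
    (forall i, i \in I_ k -> exists m, coprime_factor (M i) L m) /\
    (forall j, j \in J_ k -> exists n, coprime_factor (N j) L n).
  (* One cofactor must serve both sides, hence the disjoint union; [M k] is commensurable with all
     its members. *)
  pose X (t : {i | i \in I_ k} + {j | j \in J_ k}) :=
    match t with inl i => M (val i) | inr j => N (val j) end.
  have [|L LP] := @common_cofactor _ X (M k).
    by case=> -[i] /=; rewrite inE => /eqP/repP.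
  exists L; split=> [i iI|j jJ]; first exact: LP (inl (Sub i iI)).
  exact: LP (inr (Sub j jJ)).
have /choice[m mP] i : exists m, forall k, i \in I_ k -> coprime_factor (M i) (L k) m.
  have [k ik] := repMP i; have [|m mk] := (LP k).1 i; first by rewrite inE ik.
  by exists m => k'; rewrite inE ik => /eqP[<-].
have /choice[n nP] j : exists n, forall k, j \in J_ k -> coprime_factor (N j) (L k) n.
  have [k jk] := repNP j; have [|n nk] := (LP k).2 j; first by rewrite inE jk.
  by exists n => k'; rewrite inE jk => /eqP[<-].
have m0 i : (0 < m i)%N.
  by have [k ik] := repMP i; have [|] := mP i k; rewrite ?inE ?ik.
have n0 j : (0 < n j)%N.
  by have [k jk] := repNP j; have [|] := nP j k; rewrite ?inE ?jk.
have BA k : forall i i', i \in I_ k -> i' \in I_ k ->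
    \sum_(j in J_ k) entry rho' i j * entry rho j i' = (i == i')%:R.
  apply: block_inverse MN NM _ _ => // [i i'|i j].
    rewrite !inE => /eqP/repP ik /eqP/repP ik'.
    exact: commensurable_trans ik (commensurable_sym ik').
  by rewrite !inE => /eqP <- /rep_eq ->.
have AB k : forall j j', j \in J_ k -> j' \in J_ k ->
    \sum_(i in I_ k) entry rho j i * entry rho' i j' = (j == j')%:R.
  apply: block_inverse NM MN _ _ => // [j j'|j i].
    rewrite !inE => /eqP/repP jk /eqP/repP jk'.
    exact: commensurable_trans jk (commensurable_sym jk').
  by rewrite !inE => /eqP <- /rep_eq ->.
exists I, L, I_, J_; split.
- move=> i; have [k ik] := repMP i; exists k; split; first by rewrite inE ik.
  by move=> k'; rewrite inE ik => /eqP[].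
- move=> j; have [k jk] := repNP j; exists k; split; first by rewrite inE jk.
  by move=> k'; rewrite inE jk => /eqP[].
- by move=> k; exact: card_block (BA k) (AB k).
exists m, n => k; split=> [i /mP|j /nP|]; [exact: coprime_factor_unique..|].
apply: block_map_isog (BA k) (AB k) => // [i j /mP mi /nP nj|j i /nP nj /mP mi].
  exact: coprime_factor_scales mi nj (MN i j).
exact: coprime_factor_scales nj mi (NM j i).
Qed.

End Commensurability.

(** * Torsion in products of cyclic groups *)

Section Torsion.

Lemma card_dvdn_ord q m : 0 < q -> q %| m -> #|[set x : 'I_m | q %| x]| = m %/ q.
Proof.
case: m => [|m] q0 qm; first by rewrite div0n; apply: eq_card0 => -[].
rewrite -sum1_card big_mkcond (eq_bigr (fun x : 'I_m.+1 => (q %| x) : nat)); last first.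
  by move=> x _; rewrite inE; case: (q %| x).
(* [divn_count_dvd] counts from 1 up to the modulus, while ordinals start at 0 and stop below it;
   the modulus and 0, both multiples of [q], are exchanged. *)
rewrite divn_count_dvd (big_nat_recr m.+1)//= qm big_ord_recl dvdn0 addnC.
by rewrite big_add1 big_mkord.
Qed.

(** With g = gcd(e, m), the numbers m/g and e/g are coprime, so m divides x e exactly when m/g
    divides x; there are g such x below m. *)
Lemma card_cyc_torsion m e : 0 < m ->
  #|[set x : cyc m | (x ^+ e == 1)%g]| = gcdn e m.
Proof.
case: m => // m _ /=; have g0 : 0 < gcdn e m.+1 by rewrite gcdn_gt0 orbT.
have co : coprime (m.+1 %/ gcdn e m.+1) (e %/ gcdn e m.+1).
  rewrite /coprime gcdnC -(eqn_pmul2r g0) muln_gcdl.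
  by rewrite !divnK ?dvdn_gcdl ?dvdn_gcdr// mul1n.
transitivity #|[set x : 'I_m.+1 | m.+1 %/ gcdn e m.+1 %| x]|.
  apply: eq_card => x; rewrite !inE FinRing.zmodXgE FinRing.zmod1gE Zp_mulrn -val_eqE /=.
  rewrite -/(dvdn m.+1 (x * e)).
  rewrite -[X in X %| x * e](divnK (dvdn_gcdr e m.+1)).
  rewrite -[X in _ %| x * X](divnK (dvdn_gcdl e m.+1)) mulnA dvdn_pmul2r//.
  by rewrite Gauss_dvdl.
have gm := dvdn_gcdr e m.+1.
have q0 : 0 < m.+1 %/ gcdn e m.+1 by rewrite divn_gt0//; exact: dvdn_leq.
have qm : m.+1 %/ gcdn e m.+1 %| m.+1.
  by apply/dvdnP; exists (gcdn e m.+1); rewrite mulnC divnK.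
rewrite card_dvdn_ord//; apply/eqP; rewrite -(eqn_pmul2r q0) divnK//.
by rewrite mulnC divnK.
Qed.

Lemma isog_card_torsion (gT hT : finGroupType) e :
  [set: gT] \isog [set: hT] ->
  #|[set x : gT | (x ^+ e == 1)%g]| = #|[set y : hT | (y ^+ e == 1)%g]|.
Proof.
case/isogP => f /injmP finj fG; rewrite -(card_in_imset (f := f)) => [|x y _ _].
  apply: eq_card => y; apply/imsetP/idP => [[x]|].
    by rewrite !inE => /eqP xe ->; rewrite -morphX ?inE// xe morph1.
  rewrite inE => /eqP ye; have : y \in [set: hT] by rewrite inE.
  rewrite -fG => /morphimP[x xG _ yE]; exists x => //; rewrite inE; apply/eqP.
  by apply: finj; rewrite ?inE// morphX// -yE ye morph1.
by apply: finj; rewrite inE.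
Qed.

Lemma card_cyclic_prod_torsion (I : finType) (S : {set I}) (m : I -> nat) e :
  (forall i, 0 < m i) ->
  #|[set x : cyclic_prod S m | (x ^+ e == 1)%g]| = \prod_(i in S) gcdn e (m i).
Proof.
move=> m0.
pose U (i : {i | i \in S}) := [set x : cyc (m (val i)) | (x ^+ e == 1)%g].
transitivity #|setXn U|.
  have exE (x : cyclic_prod S m) i : ((x ^+ e) i = x i ^+ e)%g.
    by elim: e {U} => [|e IH]; rewrite ?expg0 ?oneg_ffun// !expgS mulg_ffun IH.
  apply: eq_card => x; rewrite in_setXn inE; apply/eqP/forallP => [xe i|xe].
    by rewrite inE -exE xe oneg_ffun.
  by apply/ffunP => i; move/(_ i): xe; rewrite inE -exE oneg_ffun => /eqP.
rewrite cardsXn (eq_bigr (fun i => gcdn e (m (val i)))); last first.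
  by move=> i _; exact: card_cyc_torsion.
by rewrite [RHS](@big_sub _ _ _ I (mem S) (fun i => gcdn e (m i))); apply: eq_bigl => i.
Qed.

End Torsion.

(** * Diagonal lattices *)

Section Lattices.
Local Open Scope ring_scope.

Definition pair_map (I : finType) (i1 i2 : I) (p q r s : int)
    (x : {ffun I -> int}) : {ffun I -> int} :=
  [ffun i => if i == i1 then p * x i1 + q * x i2
             else if i == i2 then r * x i1 + s * x i2 else x i].

Lemma pair_map_is_zmod_morphism (I : finType) (i1 i2 : I) p q r s :
  zmod_morphism (pair_map i1 i2 p q r s).
Proof.
by move=> x y; apply/ffunP => i; rewrite !ffunE; do 2?case: ifP => _; ring.
Qed.

HB.instance Definition _ (I : finType) (i1 i2 : I) p q r s :=
  GRing.isZmodMorphism.Build _ _ _ (pair_map_is_zmod_morphism i1 i2 p q r s).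

Lemma pair_mapK (I : finType) (i1 i2 : I) p q r s p' q' r' s' : i1 != i2 ->
  p' * p + q' * r = 1 -> p' * q + q' * s = 0 ->
  r' * p + s' * r = 0 -> r' * q + s' * s = 1 ->
  cancel (pair_map i1 i2 p q r s) (pair_map i1 i2 p' q' r' s').
Proof.
move=> i12 e11 e12 e21 e22 x; apply/ffunP => i; rewrite !ffunE eqxx.
rewrite [i2 == i1]eq_sym (negPf i12) eqxx; case: eqP => [->|_].
  transitivity ((p' * p + q' * r) * x i1 + (p' * q + q' * s) * x i2); first by ring.
  by rewrite e11 e12; ring.
case: eqP => // ->.
transitivity ((r' * p + s' * r) * x i1 + (r' * q + s' * s) * x i2); first by ring.
by rewrite e21 e22; ring.
Qed.

(* For d = 0 the condition says that f is block diagonal, for d = 1 that it maps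
   the lattice defined by m into the one defined by m'. *)
Definition block_hom (I K : finType) (kappa : I -> K) (m m' : I -> nat)
    (f : {ffun I -> int} -> {ffun I -> int}) : Prop :=
  forall (d : nat) k (x : {ffun I -> int}),
    (forall i, kappa i = k -> (d * m i %| x i)%Z) ->
    forall i, kappa i = k -> (d * m' i %| f x i)%Z.

(** A unimodular matrix, block diagonal along [kappa], that carries the lattice of [m] onto the
    lattice of [m']; the condition on [g] gives surjectivity. *)
Definition lattice_equiv (I K : finType) (kappa : I -> K) (m m' : I -> nat) :=
  exists f g : {additive {ffun I -> int} -> {ffun I -> int}},
    [/\ cancel f g, cancel g f, block_hom kappa m m' f & block_hom kappa m' m g].

Lemma lattice_equiv_refl (I K : finType) (kappa : I -> K) m :
  lattice_equiv kappa m m.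
Proof. by exists idfun, idfun; split=> // d k x xm i ik; exact: xm. Qed.

Lemma lattice_equiv_sym (I K : finType) (kappa : I -> K) m m' :
  lattice_equiv kappa m m' -> lattice_equiv kappa m' m.
Proof. by move=> [f [g [fK gK fm gm]]]; exists g, f. Qed.

Lemma lattice_equiv_trans (I K : finType) (kappa : I -> K) m2 m1 m3 :
  lattice_equiv kappa m1 m2 -> lattice_equiv kappa m2 m3 ->
  lattice_equiv kappa m1 m3.
Proof.
move=> [f [g [fK gK fm gm]]] [f' [g' [fK' gK' fm' gm']]].
exists (f' \o f), (g \o g'); split; [exact: can_comp|exact: can_comp|..].
  by move=> d k x xm; apply: fm'; exact: fm.
by move=> d k x xm; apply: gm; exact: gm'.
Qed.

(* Z/a x Z/b = Z/lcm(a,b) x Z/gcd(a,b), realised by a unimodular matrix built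
   from a Bezout relation u a' + v b' = 1, where a = a' g and b = b' g. *)
Lemma lattice_equiv_lcm_gcd (I K : finType) (kappa : I -> K) (m : I -> nat) i1 i2 :
  i1 != i2 -> kappa i1 = kappa i2 -> (0 < m i1)%N ->
  lattice_equiv kappa m
    (fun i => if i == i1 then lcmn (m i1) (m i2)
              else if i == i2 then gcdn (m i1) (m i2) else m i).
Proof.
move=> i12 k12 m10; pose g := gcdn (m i1) (m i2).
have g0 : (0 < g)%N by rewrite gcdn_gt0 m10.
have /dvdnP[a aE] : (g %| m i1)%N by exact: dvdn_gcdl.
have /dvdnP[b bE] : (g %| m i2)%N by exact: dvdn_gcdr.
have lE : lcmn (m i1) (m i2) = (a * b * g)%N.
  apply/eqP; rewrite -(eqn_pmul2r g0) muln_lcm_gcd aE bE; apply/eqP; lia.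
have [u [v uv]] : exists u v : int, u * a + v * b = 1.
  have [u [v uvg]] := Bezoutz (m i1) (m i2); exists u, v.
  have gE : gcdz (m i1) (m i2) = g by [].
  apply: (mulIf (x := g%:Z)); first by rewrite -lt0n.
  by rewrite mul1r -[RHS]gE -uvg aE bE !PoszM; ring.
have ba : v * b = 1 - u * a by rewrite -uv; ring.
(* The matrix with rows (v b, -u a) and (1, 1) has determinant v b + u a = 1, and its inverse has
   rows (1, u a) and (-1, v b). *)
exists (pair_map i1 i2 (v * b) (- (u * a)) 1 1).
exists (pair_map i1 i2 1 (u * a) (-1) (v * b)).
split; [by apply: pair_mapK => //; rewrite ?ba; ring..| |].
- move=> d k x xm i ik; rewrite ffunE; case: eqP => [ii1|_].
    have /dvdzP[y ->] := xm i1 (etrans (congr1 kappa (esym ii1)) ik).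
    have /dvdzP[z ->] := xm i2 (etrans (etrans (esym k12) (congr1 kappa (esym ii1))) ik).
    apply/dvdzP; exists (v * y - u * z).
    by rewrite lE aE bE !PoszM; ring.
  case: eqP => [ii2|_]; last exact: xm.
  have /dvdzP[y ->] := xm i1 (etrans (etrans k12 (congr1 kappa (esym ii2))) ik).
  have /dvdzP[z ->] := xm i2 (etrans (congr1 kappa (esym ii2)) ik).
  apply/dvdzP; exists (a%:Z * y + b%:Z * z).
  by rewrite -/g aE bE !PoszM; ring.
- move=> d k x xm i ik; rewrite ffunE.
  case: (eqVneq i i1) => [ii1|ii1]; last first.
    case: (eqVneq i i2) => [ii2|ii2]; last first.
      by have := xm i ik; rewrite (negPf ii1) (negPf ii2).
    have := xm i1 (etrans (etrans k12 (congr1 kappa (esym ii2))) ik).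
    have := xm i2 (etrans (congr1 kappa (esym ii2)) ik).
    rewrite eqxx [i2 == i1]eq_sym (negPf i12) eqxx -/g lE.
    move=> /dvdzP[z ->] /dvdzP[y ->].
    by apply/dvdzP; exists (v * z - a%:Z * y); rewrite ii2 bE !PoszM; ring.
  have := xm i1 (etrans (congr1 kappa (esym ii1)) ik).
  have := xm i2 (etrans (etrans (esym k12) (congr1 kappa (esym ii1))) ik).
  rewrite eqxx [i2 == i1]eq_sym (negPf i12) eqxx -/g lE.
  move=> /dvdzP[z ->] /dvdzP[y ->].
  by apply/dvdzP; exists (u * z + b%:Z * y); rewrite ii1 aE !PoszM; ring.
Qed.

End Lattices.

(** At each prime the maximum and minimum of the exponents of [a] and [b] are just these exponents
    reordered, and both sides cap them by the exponent of [e]. *)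
Lemma gcdn_lcm_gcd e a b : 0 < a -> 0 < b ->
  gcdn e (lcmn a b) * gcdn e (gcdn a b) = gcdn e a * gcdn e b.
Proof.
move=> a0 b0.
have [e0|e0] := posnP e; first by rewrite e0 !gcd0n muln_lcm_gcd.
apply: eqn_from_log; rewrite ?muln_gt0 ?gcdn_gt0 ?e0// => p.
rewrite !lognM ?gcdn_gt0 ?e0// !logn_gcd ?lcmn_gt0 ?gcdn_gt0 ?a0 ?b0//.
by rewrite logn_lcm//; lia.
Qed.

(** * Diagonal lattices are determined by torsion counts *)

Section Rigidity.

(** The exchange of (a, b) for (lcm, gcd) is applied to [i0] and each member of [s] in turn. The
    entry at [i0] accumulates the lcm, and every exchange preserves the products of gcds. *)
Lemma lattice_equiv_concentrate (I K : finType) (kappa : I -> K) (m : I -> nat)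
    (i0 : I) (s : seq I) :
  (forall i, 0 < m i) -> (forall i, i \in s -> kappa i = kappa i0) ->
  exists m', [/\ lattice_equiv kappa m m',
    (forall i, 0 < m' i) /\ (forall i, i \in s -> m' i %| m' i0),
    forall i, i != i0 -> i \notin s -> m' i = m i &
    forall e (T : {set I}), i0 \in T -> {subset s <= T} ->
      \prod_(i in T) gcdn e (m' i) = \prod_(i in T) gcdn e (m i)].
Proof.
move=> m0; elim: s => [|i1 s IH] sk.
  by exists m; split=> //; exact: lattice_equiv_refl.
have [|m' [mm' [m'0 m'dvd] m'E m'prod]] := IH.
  by move=> i si; apply: sk; rewrite inE si orbT.
(* The list may contain [i0] itself, as the enumeration of its block does; then there is nothing to
   exchange. *)
have [i10|i01] := eqVneq i1 i0.
  exists m'; split=> //.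
  - by split=> // i; rewrite inE => /predU1P[->|/m'dvd//]; rewrite i10.
  - by move=> i ii0; rewrite inE negb_or => /andP[_]; exact: m'E.
  - by move=> e T i0T sT; apply: m'prod => // i si; apply: sT; rewrite inE si orbT.
rewrite eq_sym in i01.
pose m'' i := if i == i0 then lcmn (m' i0) (m' i1)
              else if i == i1 then gcdn (m' i0) (m' i1) else m' i.
have m''0 : m'' i0 = lcmn (m' i0) (m' i1) by rewrite /m'' eqxx.
have m''1 : m'' i1 = gcdn (m' i0) (m' i1).
  by rewrite /m'' eq_sym (negPf i01) eqxx.
have m''E i : i != i0 -> i != i1 -> m'' i = m' i.
  by rewrite /m'' => /negPf-> /negPf->.
exists m''; split.
- apply: lattice_equiv_trans mm' _; apply: lattice_equiv_lcm_gcd => //.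
  by rewrite sk// inE eqxx.
- split=> i.
    by rewrite /m''; do 2?case: ifP => _; rewrite ?lcmn_gt0 ?gcdn_gt0 ?m'0.
  have [->//|ii0] := eqVneq i i0; have [->|ii1] := eqVneq i i1.
    by rewrite m''0 m''1 (dvdn_trans (dvdn_gcdl _ _))// dvdn_lcml.
  rewrite inE (negPf ii1) m''E//= => /m'dvd; rewrite m''0 => /dvdn_trans; apply.
  exact: dvdn_lcml.
- move=> i ii0; rewrite inE negb_or => /andP[ii1 si].
  by rewrite m''E// m'E.
move=> e T i0T sT; rewrite -m'prod//; last first.
  by move=> i si; apply: sT; rewrite inE si orbT.
have i1T : i1 \in T by apply: sT; rewrite inE eqxx.
have i1T' : (i1 \in T) && (i1 != i0) by rewrite i1T eq_sym.
rewrite !(bigD1 (P := mem T) i0)//=.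
rewrite !(bigD1 (P := fun i => (i \in T) && (i != i0)) i1)//=.
rewrite m''0 m''1 !mulnA gcdn_lcm_gcd//; congr (_ * _).
by apply: eq_bigr => i /andP[/andP[_ ii0] ii1]; rewrite m''E.
Qed.

(** For e = m_i0 the left product is that of all m_i, which equals that of all n_i. The right
    factors gcd(m_i0, n_i) are at most n_i, so all of them must equal n_i. *)
Lemma top_factor_dvd (I : finType) (T : {set I}) (i0 : I) (m n : I -> nat) :
  (forall i, 0 < m i) -> (forall i, 0 < n i) -> i0 \in T ->
  (forall i, i \in T -> m i %| m i0) ->
  (forall e, \prod_(i in T) gcdn e (m i) = \prod_(i in T) gcdn e (n i)) ->
  n i0 %| m i0.
Proof.
move=> m0 n0 i0T mdvd mn.
have mnE : \prod_(i in T) m i = \prod_(i in T) n i.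
  (* A common multiple of all [m i] and [n i], for which the gcds are the numbers themselves. *)
  pose e := (\prod_(i in T) m i) * (\prod_(i in T) n i).
  have := mn e.
  rewrite (eq_bigr m) => [|i iT]; last first.
    by apply/gcdn_idPr; rewrite dvdn_mulr// (bigD1 i)//= dvdn_mulr.
  rewrite [in RHS](eq_bigr n) => [//|i iT].
  by apply/gcdn_idPr; rewrite dvdn_mull// (bigD1 i)//= dvdn_mulr.
have := mn (m i0); rewrite (eq_bigr m) => [|i iT]; last by apply/gcdn_idPr; exact: mdvd.
rewrite mnE (bigD1 i0)//= [in RHS](bigD1 i0)//= => nE.
set P := \prod_(i in T | i != i0) n i in nE.
set Q := \prod_(i in T | i != i0) gcdn _ _ in nE.
have QP : Q <= P by apply: leq_prod => i _; rewrite dvdn_leq// dvdn_gcdr.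
have P0 : 0 < P by apply: prodn_cond_gt0 => i _.
suff /eqP <- : gcdn (m i0) (n i0) == n i0 by exact: dvdn_gcdl.
rewrite eqn_leq dvdn_leq ?dvdn_gcdr//= leqNgt; apply/negP => lt.
have : gcdn (m i0) (n i0) * Q < n i0 * P.
  apply: (leq_ltn_trans (n := gcdn (m i0) (n i0) * P)).
    by rewrite leq_mul2l QP orbT.
  by rewrite ltn_pmul2r.
by rewrite nE ltnn.
Qed.

(** Induction on a set [S] outside which [m] and [n] agree. Within the block of some [i0] in [S],
    both families are concentrated at [i0]; by [top_factor_dvd] their entries there divide each
    other, so [i0] can be removed from [S]. *)
Lemma lattice_equiv_of_gcd (I K : finType) (kappa : I -> K) (m n : I -> nat) :
  (forall i, 0 < m i) -> (forall i, 0 < n i) ->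
  (forall k e, \prod_(i | kappa i == k) gcdn e (m i) =
               \prod_(i | kappa i == k) gcdn e (n i)) ->
  lattice_equiv kappa m n.
Proof.
move=> m0 n0 mn.
suff : forall (S : {set I}) m n, (forall i, 0 < m i) -> (forall i, 0 < n i) ->
    (forall i, i \notin S -> m i = n i) ->
    (forall k e, \prod_(i in S | kappa i == k) gcdn e (m i) =
                 \prod_(i in S | kappa i == k) gcdn e (n i)) ->
    lattice_equiv kappa m n.
  move/(_ [set: I]); apply=> // [i|k e]; first by rewrite inE.
  rewrite (eq_bigl (fun i => kappa i == k)) => [|i]; last by rewrite inE.
  by rewrite [RHS](eq_bigl (fun i => kappa i == k)) => // i; rewrite inE.
move=> {m n m0 n0 mn} S; have [c] := ubnP #|S|.
elim: c S => // c IH S Sc m n m0 n0 mnS mn.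
have [S0|[i0 i0S]] := set_0Vmem S.
  have -> : m = n by apply/funext => i; apply: mnS; rewrite S0 inE.
  exact: lattice_equiv_refl.
pose T := [set i in S | kappa i == kappa i0].
have i0T : i0 \in T by rewrite inE i0S eqxx.
have Tk i : i \in enum T -> kappa i = kappa i0.
  by rewrite mem_enum inE => /andP[_ /eqP].
have sT : {subset enum T <= T} by move=> i; rewrite mem_enum.
have [m' [mm' [m'0 m'dvd] m'E m'prod]] := lattice_equiv_concentrate m0 Tk.
have [n' [nn' [n'0 n'dvd] n'E n'prod]] := lattice_equiv_concentrate n0 Tk.
have prodT f : \prod_(i in S | kappa i == kappa i0) f i = \prod_(i in T) f i.
  by apply: eq_bigl => i; rewrite !inE.
have mn' e : \prod_(i in T) gcdn e (m' i) = \prod_(i in T) gcdn e (n' i).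
  by rewrite m'prod// n'prod// -!prodT.
have top : m' i0 = n' i0.
  apply/eqP; rewrite eqn_dvd; apply/andP; split.
    by apply: (@top_factor_dvd _ T _ n' m') => // i iT; apply: n'dvd; rewrite mem_enum.
  by apply: (@top_factor_dvd _ T _ m' n') => // i iT; apply: m'dvd; rewrite mem_enum.
apply: lattice_equiv_trans mm' _; apply: lattice_equiv_trans (lattice_equiv_sym nn').
apply: (IH (S :\ i0)) => //.
- by move: Sc; rewrite (cardsD1 i0) i0S.
- move=> i; rewrite !inE negb_and negbK; have [->//|ii0 /= iS] := eqVneq i i0.
  by rewrite m'E ?n'E ?mem_enum ?inE ?(negPf iS)//; exact: mnS.
move=> k e; have [->|ki0] := eqVneq k (kappa i0).
  (* In the block of [i0] the common factor at [i0] is cancelled; it is positive even for [e] =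
     0. *)
  apply/eqP; rewrite -(eqn_pmul2l (m := gcdn e (m' i0))); last first.
    by rewrite gcdn_gt0 m'0 orbT.
  have DT f : \prod_(i in S :\ i0 | kappa i == kappa i0) f i =
      \prod_(i in T | i != i0) f i.
    by apply: eq_bigl => i; rewrite !inE andbC andbA andbC andbA.
  rewrite !DT {2}top.
  by have := mn' e; rewrite (bigD1 i0)//= [RHS](bigD1 i0)//= => ->.
(* Concentration changes only the block of [i0], so the counts in the other blocks are the original
   ones. *)
have DS f g : (forall i, i != i0 -> i \notin enum T -> f i = g i) ->
    \prod_(i in S :\ i0 | kappa i == k) gcdn e (f i) =
    \prod_(i in S | kappa i == k) gcdn e (g i).
  move=> fg; apply: eq_big => [i|i /andP[_ /eqP ik]].
    rewrite !inE; have [->|//] := eqVneq i i0.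
    by rewrite [kappa i0 == k]eq_sym (negPf ki0) !andbF.
  rewrite fg//.
    by apply: contra ki0 => /eqP <-; rewrite ik.
  by rewrite mem_enum inE ik (negPf ki0) !andbF.
by rewrite (DS m' m)// (DS n' n).
Qed.

(** Elements of corresponding fibres are matched by their rank in the enumeration of the fibre. *)
Lemma block_bijection (I J K : finType) (kappa : I -> K) (lambda : J -> K) :
  (forall k, #|[set i | kappa i == k]| = #|[set j | lambda j == k]|) ->
  exists (h : I -> J) (h' : J -> I),
    [/\ cancel h h', cancel h' h & forall i, lambda (h i) = kappa i].
Proof.
move=> card_eq.
pose rank (L : finType) (mu : L -> K) x := index x (enum [set y | mu y == mu x]).
have rank_inj (L : finType) (mu : L -> K) x y :
    mu x = mu y -> rank L mu x = rank L mu y -> x = y.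
  rewrite /rank => muxy rxy.
  have memE z : mu z = mu y -> z \in enum [set t | mu t == mu y].
    by rewrite mem_enum inE => ->.
  rewrite muxy in rxy.
  by rewrite -(nth_index x (memE x muxy)) rxy nth_index// memE.
have match_rank (L L' : finType) (mu : L -> K) (mu' : L' -> K) x :
    (forall k, #|[set y | mu y == k]| = #|[set y | mu' y == k]|) ->
    exists y, mu' y = mu x /\ rank L' mu' y = rank L mu x.
  move=> card_mu.
  have : rank L mu x < size (enum [set y | mu' y == mu x]).
    rewrite -cardE -card_mu cardE index_mem mem_enum inE//.
  case E: (enum _) => [//|y0 s]; rewrite -E => lt.
  have := mem_nth y0 lt; rewrite mem_enum inE => /eqP muy.
  exists (nth y0 (enum [set y | mu' y == mu x]) (rank L mu x)); split => //.
  by rewrite {1}/rank muy index_uniq ?enum_uniq.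
have /choice[h hP] i := match_rank I J kappa lambda i card_eq.
have /choice[h' hP'] j := match_rank J I lambda kappa j (fun k => esym (card_eq k)).
exists h, h'; split=> [i|j|i].
- apply: (@rank_inj I kappa).
    by rewrite (hP' (h i)).1 (hP i).1.
  by rewrite (hP' (h i)).2 (hP i).2.
- apply: (@rank_inj J lambda).
    by rewrite (hP (h' j)).1 (hP' j).1.
  by rewrite (hP (h' j)).2 (hP' j).2.
- exact: (hP i).1.
Qed.

End Rigidity.

(** * Realizing block isomorphisms *)

Section Realization.
Local Open Scope ring_scope.

(** Converse to [coprime_factor_scales]: [L] adds the same exponent to both sides of the
    divisibility. *)
Lemma scales_coprime_factor M N L m n (c : int) :
  coprime_factor M L m -> coprime_factor N L n -> (n %| c * m)%Z -> scales M N c.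
Proof.
move=> [m0 Mm _] [n0 Nn _] nm.
have [->|c0] := eqVneq c 0; [by left|right=> p pp e].
have : (logn p n <= logn p `|c| + logn p m)%N.
  rewrite -lognM ?absz_gt0//; apply: dvdn_leq_log; first by rewrite muln_gt0 absz_gt0 c0.
  by move: nm; rewrite dvdzE abszM !absz_nat.
by rewrite Mm// Nn//; case: (vp L p) => //= l; lia.
Qed.

(** Taking d = 0 on a unit vector kills the entries between different blocks; taking d = 1 on [m i]
    times a unit vector gives the divisibility within a block. *)
Lemma block_hom_scales (I K : finType) (kappa : I -> K)
    (M N : I -> supernatural) (L : K -> supernatural) (m n : I -> nat)
    (f : {additive {ffun I -> int} -> {ffun I -> int}}) :
  (forall i, coprime_factor (M i) (L (kappa i)) (m i)) ->
  (forall i, coprime_factor (N i) (L (kappa i)) (n i)) ->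
  block_hom kappa m n f -> forall i i', scales (M i) (N i') (entry f i' i).
Proof.
move=> Mm Nn fmn i i'; have [ii'|ii'] := eqVneq (kappa i) (kappa i'); last first.
  left; have := fmn 0%N (kappa i') (unitv i) _ i' erefl.
  rewrite mul0r dvd0z => fi; apply/eqP/fi => i2 i2k; rewrite ffunE mul0r dvd0z.
  by have [i2i|//] := eqVneq i2 i; rewrite -i2k i2i eqxx in ii'.
apply: (scales_coprime_factor (Mm i)); first by rewrite ii'; exact: Nn.
have := fmn 1%N (kappa i') (unitv i *~ (m i : int)) _ i' erefl.
rewrite raddfMz ffunMzE mulrzz mul1r; apply=> i2 _.
rewrite ffunMzE ffunE mul1r; case: eqP => [->|_]; last by rewrite mul0rz dvdz0.
by rewrite intz dvdzz.
Qed.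

Definition reindex_ffun (I J : finType) (h : J -> I) (x : {ffun I -> int}) :
  {ffun J -> int} := [ffun j => x (h j)].

Lemma reindex_ffun_is_zmod_morphism (I J : finType) (h : J -> I) :
  zmod_morphism (reindex_ffun h).
Proof. by move=> x y; apply/ffunP => j; rewrite !ffunE. Qed.

HB.instance Definition _ (I J : finType) (h : J -> I) :=
  GRing.isZmodMorphism.Build _ _ _ (reindex_ffun_is_zmod_morphism h).

Lemma reindex_ffunK (I J : finType) (h : J -> I) (h' : I -> J) :
  cancel h' h -> cancel (reindex_ffun h) (reindex_ffun h').
Proof. by move=> hK x; apply/ffunP => j; rewrite !ffunE hK. Qed.

Lemma decompositionP (K I : finType) (I_ : K -> {set I}) :
  decomposition I_ -> exists kappa : I -> K, forall k i, (i \in I_ k) = (kappa i == k).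
Proof.
move=> /choice[kappa kP]; exists kappa => k i; have [ik iu] := kP i.
by apply/idP/eqP => [/iu//|<-].
Qed.

(** A block-preserving bijection [h] transports [n] to [I]. Isomorphic products have equal torsion
    counts, so [m] and [n \o h] define equivalent lattices, and the equivalence composed with the
    reindexing gives [rho]. *)
Lemma block_realization (I J : finType) (M : I -> supernatural)
    (N : J -> supernatural) (K : finType) (L : K -> supernatural)
    (I_ : K -> {set I}) (J_ : K -> {set J}) (m : I -> nat) (n : J -> nat) :
  decomposition I_ -> decomposition J_ -> (forall k, #|I_ k| = #|J_ k|) ->
  (forall k i, i \in I_ k -> coprime_factor (M i) (L k) (m i)) ->
  (forall k j, j \in J_ k -> coprime_factor (N j) (L k) (n j)) ->
  (forall k, [set: cyclic_prod (I_ k) m] \isog [set: cyclic_prod (J_ k) n]) ->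
  exists (rho : {additive {ffun I -> int} -> {ffun J -> int}})
      (rho' : {additive {ffun J -> int} -> {ffun I -> int}}),
    [/\ cancel rho rho', cancel rho' rho,
        forall i j, scales (M i) (N j) (entry rho j i) &
        forall j i, scales (N j) (M i) (entry rho' i j)].
Proof.
move=> /decompositionP[kappa IE] /decompositionP[lambda JE] cardIJ Mm Nn isog.
have [|h [h' [hK hK' lh]]] := @block_bijection I J K kappa lambda.
  move=> k; have := cardIJ k.
  rewrite (_ : I_ k = [set i | kappa i == k]); last by apply/setP => i; rewrite inE IE.
  by rewrite (_ : J_ k = [set j | lambda j == k])//; apply/setP => j; rewrite inE JE.
have Mm' i : coprime_factor (M i) (L (kappa i)) (m i) by apply: Mm; rewrite IE.
have Nn' j : coprime_factor (N j) (L (lambda j)) (n j) by apply: Nn; rewrite JE.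
have m0 i : (0 < m i)%N by case: (Mm' i).
have n0 j : (0 < n j)%N by case: (Nn' j).
have [||f [g [fK gK fmn gnm]]] := @lattice_equiv_of_gcd I K kappa m (n \o h) m0.
- by move=> i /=.
- move=> k e; rewrite -(eq_bigl _ _ (IE k)) -card_cyclic_prod_torsion//.
  rewrite (isog_card_torsion e (isog k)) card_cyclic_prod_torsion//.
  rewrite (eq_bigl _ _ (JE k)).
  rewrite (reindex h) /=; first by apply: eq_bigl => i; rewrite lh.
  by exists h' => i _.
exists (reindex_ffun h' \o f), (g \o reindex_ffun h); split.
- by apply: can_comp => //; exact: reindex_ffunK.
- by apply: can_comp => //; exact: reindex_ffunK.
- move=> i j; rewrite /entry /= ffunE -{1}(hK' j).
  apply: (block_hom_scales (N := N \o h) Mm' _ fmn) => i'.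
  by rewrite /= -lh.
- move=> j i; rewrite /entry /=.
  have -> : reindex_ffun h (unitv j) = unitv (h' j).
    by apply/ffunP => i'; rewrite !ffunE -(can_eq hK) hK'.
  rewrite -{1}(hK' j); apply: (block_hom_scales (M := N \o h) _ Mm' gnm) => i'.
  by rewrite /= -lh.
Qed.

End Realization.

Theorem theorem3p4 (I J : finType)
    (M : I -> supernatural) (N : J -> supernatural)
    (a : forall i, approx (M i)) (b : forall j, approx (N j)) :
  conjugate_actions (odometer_prod a) (odometer_prod b) <->
  exists (K : finType) (L : K -> supernatural)
         (I_ : K -> {set I}) (J_ : K -> {set J}),
    [/\ decomposition I_, decomposition J_,
        forall k, #|I_ k| = #|J_ k| &
        exists (m : I -> nat) (n : J -> nat), forall k,
          [/\ forall i, i \in I_ k -> unique (coprime_factor (M i) (L k)) (m i),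
              forall j, j \in J_ k -> unique (coprime_factor (N j) (L k)) (n j) &
              [set: cyclic_prod (I_ k) m] \isog [set: cyclic_prod (J_ k) n]]].
Proof.
apply: iff_trans (conjugate_adicP a b) _; split.
  move=> [rho [rho' [rhoK rhoK' /adic_entryP MN /adic_entryP NM]]].
  exact: block_structure rhoK rhoK' MN NM.
move=> [K [L [I_ [J_ [decI decJ cardIJ [m [n mnP]]]]]]].
have [|||rho [rho' [rhoK rhoK' MN NM]]] :=
  block_realization (M := M) (N := N) (L := L) (m := m) (n := n) decI decJ cardIJ.
- by move=> k i iI; have [/(_ i iI)[]] := mnP k.
- by move=> k j jJ; have [_ /(_ j jJ)[]] := mnP k.
- by move=> k; have [] := mnP k.
by exists rho, rho'; split => //; apply/adic_entryP.
Qed.
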